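(* The class of 2-oscillating paratopological groups contains all topological groups, all paratopological LSIN-groups and all saturated paratopological groups.
   Context: A paratopological group is a group $G$ with a topology $\tau$ making the group operation $G\times G\to G$ continuous; if inversion is also continuous it is a topological group (no separation axiom is assumed). $\tau_\flat$ denotes the strongest group topology (topology making $G$ a topological group) on $G$ that is weaker than $\tau$, and $G^\flat=(G,\tau_\flat)$. For a subset $U$ of a group put $(\pm U)^n=UU^{-1}U\cdots U^{(-1)^{n-1}}$ ($n$ alternating factors, starting with $U$). A paratopological group $G$ is 2-oscillating if there is a positive integer $n\le 2$ such that for any neighborhood $U$ of the unit $e$ in $G$ the set $(\pm U)^n$ is a neighborhood of $e$ in $G^\flat$; equivalently, for any neighborhood $U$ of $e$ there is a neighborhood $V$ of $e$ in $G$ with $V^{-1}V\subset UU^{-1}$. $G$ is a paratopological LSIN-group if for any neighborhood $U$ of $e$ there is a neighborhood $W$ of $e$ such that $g^{-1}Wg\subset U$ for every $g\in W$. $G$ is saturated if for any neighborhood $U$ of $e$ the set $U^{-1}$ has nonempty interior in $G$. *)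

(* Defs.v *)
From HB Require Import structures.
From mathcomp Require Import all_boot.
From mathcomp Require Import all_classical topology.

Set Implicit Arguments.
Unset Strict Implicit.
Unset Printing Implicit Defensive.

Local Open Scope classical_set_scope.
Local Open Scope group_scope.

HB.mixin Record isParatopologicalGroup G & Group G & Topological G := {
  mulg_continuous : continuous (fun x : G * G => x.1 * x.2)
}.

#[short(type="paratopologicalGroupType")]
HB.structure Definition ParatopologicalGroup :=
  {G of Group G & Topological G & isParatopologicalGroup G}.

HB.mixin Record isTopologicalGroup G & ParatopologicalGroup G := {
  invg_continuous : continuous (fun x : G => x^-1)
}.

#[short(type="topologicalGroupType")]
HB.structure Definition TopologicalGroup :=
  {G of ParatopologicalGroup G & isTopologicalGroup G}.

Definition group_topology (G : groupType) (t : Topological G) : Prop :=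
  let T : topologicalType := Topological.Pack t in
  continuous ((fun x : G * G => x.1 * x.2) : T * T -> T) /\
  continuous ((fun x : G => x^-1) : T -> T).

Definition weaker_topology (T : Type) (s t : Topological T) : Prop :=
  @open (Topological.Pack s) `<=` @open (Topological.Pack t).

Section Flat.
Variable G : paratopologicalGroupType.

Definition weaker_group_topology : Type :=
  {t : Topological G | group_topology t /\
                       weaker_topology t (Topological.class G)}.

(* A supremum of group topologies is a group topology, so the supremum of all
   those weaker than the topology of G is the strongest one (lemmas
   flat_weaker and flat_strongest). *)
Definition flat : Type :=
  sup_topology (fun t : weaker_group_topology => sval t).

HB.instance Definition _ := Topological.on flat.
HB.instance Definition _ := Group.copy flat G.

Lemma flat_cvg (t : weaker_group_topology) (x : flat) :
  nbhs x --> (x : Topological.Pack (sval t)).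
Proof.
have [+ _] := @cvg_sup G _ (fun s : weaker_group_topology => sval s) (nbhs x) x _.
by move=> /(_ cvg_id t).
Qed.

Lemma cvg_flat (F : set_system flat) (x : flat) : Filter F ->
  (forall t : weaker_group_topology, F --> (x : Topological.Pack (sval t))) ->
  F --> x.
Proof.
move=> FF cvF.
have [_] := @cvg_sup G _ (fun s : weaker_group_topology => sval s) F x FF.
exact.
Qed.

Lemma flat_mulg_continuous : continuous ((fun x => x.1 * x.2) : flat * flat -> flat).
Proof.
move=> [x y]; apply: cvg_flat => t A tA; have [[mulC _] _] := svalP t.
have [[P Q] [/= xP yQ] PQA] := mulC (x, y) A tA.
by exists (P, Q) => //; split; [exact: (flat_cvg xP)|exact: (flat_cvg yQ)].
Qed.

Lemma flat_invg_continuous : continuous ((fun x => x^-1) : flat -> flat).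
Proof.
move=> x; have FF := nbhs_filter (x : flat); apply: cvg_flat => t A tA; have [[_ invC] _] := svalP t.
exact: (flat_cvg (invC x A tA)).
Qed.

HB.instance Definition _ :=
  isParatopologicalGroup.Build flat flat_mulg_continuous.
HB.instance Definition _ := isTopologicalGroup.Build flat flat_invg_continuous.

Lemma flat_weaker : weaker_topology (Topological.class flat) (Topological.class G).
Proof.
apply/continuousP=> /= x; apply: cvg_flat => t.
by have [_ /continuousP] := svalP t; exact.
Qed.

Lemma flat_strongest (t : Topological G) :
  group_topology t -> weaker_topology t (Topological.class G) ->
  weaker_topology t (Topological.class flat).
Proof.
move=> tG tw A; rewrite !openE => tA x Ax.
exact: (@flat_cvg (exist _ t (conj tG tw)) x A (tA x Ax)).
Qed.

End Flat.

Definition mulset (G : groupType) (A B : set G) : set G :=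
  [set a * b | a in A & b in B].

Definition invset (G : groupType) (A : set G) : set G := [set a^-1 | a in A].

(* altprod A n is the product A A^-1 A ... with n alternating factors. *)
Fixpoint altprod (G : groupType) (A : set G) (n : nat) : set G :=
  if n is n'.+1 then mulset A (altprod (invset A) n') else [set 1].

Definition oscillating (k : nat) (G : paratopologicalGroupType) : Prop :=
  exists n : nat, (0 < n <= k)%N /\
    forall U : set G, nbhs (1 : G) U -> nbhs (1 : flat G) (altprod U n).

Definition LSIN (G : paratopologicalGroupType) : Prop :=
  forall U : set G, nbhs (1 : G) U ->
    exists2 W : set G, nbhs (1 : G) W &
      forall g, W g -> [set w ^ g | w in W] `<=` U.

Definition saturated (G : paratopologicalGroupType) : Prop :=
  forall U : set G, nbhs (1 : G) U -> (invset U)° !=set0.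

(* Main.v *)
Require Import Defs.
From mathcomp Require Import all_boot.
From HB Require Import structures.
From mathcomp Require Import all_classical topology.

Set Implicit Arguments.
Unset Strict Implicit.
Unset Printing Implicit Defensive.

(** The neighbourhoods of [1] in the flat topology are hard to describe, but a
    set is one of them as soon as it is a neighbourhood of [1] for some group
    topology weaker than the given one.

    For a topological group the given topology itself is such a topology, so
    that [n = 1] works.

    In the two other cases [n = 2] works because of the criterion: every
    neighbourhood [U] of [1] admits a neighbourhood [V] of [1] with
    [V^-1 V] contained in [U U^-1]. Under this criterion the sets [U U^-1] form
    a base at [1] of a group topology. They are symmetric, the conjugate of
    [U U^-1] is the same expression in the conjugate of [U], and if
    [V V <= U] and [W <= V] satisfies [W^-1 W <= V V^-1], then
    [(W W^-1) (W W^-1) <= V V V^-1 V^-1 <= U U^-1]. This topology is weaker than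
    the given one since [U <= U U^-1].

    Lemmas [LSIN_quotient_exchange] and [saturated_quotient_exchange] verify the
    criterion: an LSIN group allows small conjugations, and in a saturated group
    a translate of a neighbourhood of [1] lies in [U^-1]. *)

Local Open Scope classical_set_scope.
Local Open Scope group_scope.

Section ParatopologicalNbhs.
Variable G : paratopologicalGroupType.
Implicit Types (U V A : set G) (x y : G).

Lemma mulg_continuousl x : continuous (fun y : G => x * y).
Proof.
move=> y A xyA; have [[P Q] [/= xP yQ] PQA] := @mulg_continuous G (x, y) A xyA.
by apply: filterS yQ => z Qz; apply: (PQA (x, z)); split=> //; apply: nbhs_singleton xP.
Qed.

Lemma mulg_continuousr x : continuous (fun y : G => y * x).
Proof.
move=> y A yxA; have [[P Q] [/= yP xQ] PQA] := @mulg_continuous G (y, x) A yxA.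
by apply: filterS yP => z Pz; apply: (PQA (z, x)); split=> //; apply: nbhs_singleton xQ.
Qed.

Lemma nbhs1_translate x A : nbhs x A -> nbhs (1 : G) [set y | A (x * y)].
Proof. by have := @mulg_continuousl x 1 A; rewrite /= mulg1; exact. Qed.

Lemma nbhs_translate x U : nbhs (1 : G) U -> nbhs x [set y | U (x^-1 * y)].
Proof. by have := @mulg_continuousl x^-1 x U; rewrite /= mulVg; exact. Qed.

Lemma nbhs1_conj x U : nbhs (1 : G) U -> nbhs (1 : G) [set y | U (y ^ x)].
Proof.
have := @mulg_continuousr x x^-1 U; rewrite /= mulVg => /[apply] /nbhs1_translate.
by apply: filterS => y /=; rewrite conjgE mulgA.
Qed.

Lemma nbhs1_square U : nbhs (1 : G) U ->
  exists2 V, nbhs (1 : G) V & forall x y, V x -> V y -> U (x * y).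
Proof.
move=> U1; have [] := @mulg_continuous G (1, 1) U; first by rewrite /= mulg1.
move=> [P Q] [/= P1 Q1] PQU; exists (P `&` Q); first exact: filterI.
by move=> x y [Px _] [_ Qy]; apply: (PQU (x, y)).
Qed.

End ParatopologicalNbhs.

Lemma mem_altprod2 (G : groupType) (U : set G) (u v : G) :
  U u -> U v -> altprod U 2 (u * v^-1).
Proof.
move=> Uu Uv; exists u => //; exists v^-1; last by [].
by exists v^-1; [exists v | exists 1; rewrite ?mulg1].
Qed.

(** It suffices to exhibit a single group topology, since the flat topology is
    the strongest one. *)
Lemma nbhs_flat (G : paratopologicalGroupType) (t : Topological G) (x : G)
    (A : set G) :
  group_topology t -> weaker_topology t (Topological.class G) ->
  @nbhs _ (Topological.Pack t) x A -> nbhs (x : flat G) A.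
Proof. by move=> tG tw; apply: (@flat_cvg G (exist _ t (conj tG tw))). Qed.

(** The criterion of the introduction: small left quotients are right quotients
    of small elements. *)
Definition quotient_exchange (G : paratopologicalGroupType) : Prop :=
  forall U : set G, nbhs (1 : G) U ->
    exists2 V : set G, nbhs (1 : G) V &
      forall x y, V x -> V y -> exists u v, [/\ U u, U v & x^-1 * y = u * v^-1].

Section DivisionTopology.
Variable G : paratopologicalGroupType.

(** The hypothesis is a parameter of the type so that the topology can be
    attached to it as a canonical instance, apart from that of [G]. *)
Definition division_group & quotient_exchange G : Type := G.

Variable exG : quotient_exchange G.
Local Notation T := (division_group exG).

HB.instance Definition _ := Choice.on T.

Definition division_nbhs (x : T) : set_system T :=
  [set A | exists2 U : set G, nbhs (1 : G) U &
     forall u v : G, U u -> U v -> A ((x : G) * (u * v^-1))].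

HB.instance Definition _ := hasNbhs.Build T division_nbhs.

(** The inner factor [b^-1 c] of [a b^-1 c d^-1] is turned into a right quotient,
    after which both sides of it are products of two small elements. This
    gives both the triangle-like axiom of neighbourhoods and the continuity of
    the product. *)
Lemma division_square (U : set G) : nbhs (1 : G) U ->
  exists2 W : set G, nbhs (1 : G) W & forall a b c d, W a -> W b -> W c -> W d ->
    exists u v, [/\ U u, U v & (a * b^-1) * (c * d^-1) = u * v^-1].
Proof.
move=> /nbhs1_square[V V1 VVU]; have [W W1 WV] := exG V1.
exists (V `&` W); first exact: filterI.
move=> a b c d [Va _] [_ Wb] [_ Wc] [Vd _].
have [u [v [Vu Vv E]]] := WV b c Wb Wc.
exists (a * u), (d * v); split; [exact: VVU|exact: VVU|].
by rewrite invgM -!mulgA; congr (_ * _); rewrite mulgA E !mulgA.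
Qed.

Lemma division_nbhs_filter (x : T) : ProperFilter (nbhs x).
Proof.
split.
  by move=> [U U1 /(_ 1 1 (nbhs_singleton U1) (nbhs_singleton U1))].
split.
- by exists setT => //; exact: filterT.
- move=> A B [U U1 UA] [V V1 VB]; exists (U `&` V); first exact: filterI.
  by move=> u v [Uu Vu] [Uv Vv]; split; [exact: UA|exact: VB].
- by move=> A B AB [U U1 UA]; exists U => // u v Uu Uv; apply/AB/UA.
Qed.

Lemma division_nbhs_singleton (x : T) (A : set T) : nbhs x A -> A x.
Proof.
move=> [U /nbhs_singleton U1 UA].
by have := UA 1 1 U1 U1; rewrite invg1 !mulg1.
Qed.

Lemma division_nbhs_nbhs (x : T) (A : set T) :
  nbhs x A -> nbhs x (nbhs^~ A).
Proof.
move=> [U U1 UA]; have [W W1 WU] := division_square U1.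
exists W => // a b Wa Wb; exists W => // c d Wc Wd.
have [u [v [Uu Uv E]]] := WU a b c d Wa Wb Wc Wd.
by rewrite -mulgA E; apply: UA.
Qed.

HB.instance Definition _ := Nbhs_isNbhsTopological.Build T
  division_nbhs_filter division_nbhs_singleton division_nbhs_nbhs.

Lemma division_mulg_continuous :
  continuous ((fun x : G * G => x.1 * x.2) : T * T -> T).
Proof.
move=> [x y] A [U U1 UA]; have [W W1 WU] := division_square U1.
(* [x r y s = x y (r ^ y) s], so [r ^ y] has to be the small quotient *)
exists ([set z : T | exists a b : G, [/\ W (a ^ y), W (b ^ y) &
           z = (x : G) * (a * b^-1)]],
        [set z : T | exists c d : G, [/\ W c, W d & z = (y : G) * (c * d^-1)]]).
  split=> /=.
    by exists [set a | W (a ^ y)]; [exact: nbhs1_conj|move=> a b; exists a, b].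
  by exists W => // c d; exists c, d.
move=> [_ _] [/= [a [b [Wa Wb ->]]] [c [d [Wc Wd ->]]]].
have [u [v [Uu Uv E]]] := WU _ _ _ _ Wa Wb Wc Wd.
suff -> : x * (a * b^-1) * (y * (c * d^-1)) = x * y * (u * v^-1) by exact: UA.
by rewrite -E -conjVg -conjMg conjgE !mulgA mulgK.
Qed.

(** The base is symmetric and stable under conjugation:
    [(x r)^-1 = x^-1 (r^-1 ^ x^-1)]. *)
Lemma division_invg_continuous : continuous ((fun x : G => x^-1) : T -> T).
Proof.
move=> x A [U U1 UA]; exists [set a | U (a ^ x^-1)]; first exact: nbhs1_conj.
move=> a b Ua Ub /=.
have := UA _ _ Ub Ua.
by rewrite -conjVg -conjMg conjgE invgK !invgM invgK !mulgA mulVg mul1g.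
Qed.

Lemma division_group_topology : @group_topology G (Topological.class T).
Proof. by split; [exact: division_mulg_continuous|exact: division_invg_continuous]. Qed.

(** [U <= U U^-1] because [1] belongs to [U]. *)
Lemma division_weaker :
  @weaker_topology G (Topological.class T) (Topological.class G).
Proof.
move=> A; rewrite !openE => Ao x /Ao[U U1 UA].
apply: filterS (nbhs_translate x U1) => y /= Uy.
have := UA _ 1 Uy (nbhs_singleton U1).
by rewrite invg1 mulg1 mulVKg.
Qed.

End DivisionTopology.

Lemma quotient_exchange_oscillating (G : paratopologicalGroupType) :
  quotient_exchange G -> oscillating 2 G.
Proof.
move=> exG; exists 2; split=> // U U1.
apply: (nbhs_flat (division_group_topology exG) (division_weaker (exG := exG))).
by exists U => // u v Uu Uv; rewrite mul1g; apply: mem_altprod2.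
Qed.

Lemma topological_oscillating (G : topologicalGroupType) : oscillating 2 G.
Proof.
exists 1%N; split=> // U U1; apply: (@nbhs_flat G (Topological.class G)).
- by split; [exact: mulg_continuous|exact: invg_continuous].
- by [].
- by apply: filterS U1 => x Ux; exists x => //; exists 1; rewrite ?mulg1.
Qed.

(** [g^-1 w = w^g g^-1], where [w^g] is small by hypothesis. *)
Lemma LSIN_quotient_exchange (G : paratopologicalGroupType) :
  LSIN G -> quotient_exchange G.
Proof.
move=> lsinG U U1; have [W W1 WU] := lsinG U U1.
exists (U `&` W); first exact: filterI.
move=> g w [Ug Wg] [_ Ww]; exists (w ^ g), g; split=> //.
  by apply: (WU g Wg); exists w.
by rewrite conjgE mulgA mulgK.
Qed.

(** If [x V <= U^-1], the translation by [x] cancels in left quotients: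
    [V^-1 V = (x V)^-1 (x V) <= U U^-1]. *)
Lemma saturated_quotient_exchange (G : paratopologicalGroupType) :
  saturated G -> quotient_exchange G.
Proof.
move=> satG U /satG[x /nbhs1_translate Ux]; eexists; first exact: Ux.
move=> y z [u Uu uE] [v Uv vE]; exists u, v; split=> //.
by rewrite vE -[u]invgK uE invgM mulgA mulgVK.
Qed.

Theorem proposition3 :
  [/\ forall G : topologicalGroupType, oscillating 2 G,
      forall G : paratopologicalGroupType, LSIN G -> oscillating 2 G &
      forall G : paratopologicalGroupType, saturated G -> oscillating 2 G].
Proof.
split=> [G|G /LSIN_quotient_exchange|G /saturated_quotient_exchange].
- exact: topological_oscillating.
- exact: quotient_exchange_oscillating.
- exact: quotient_exchange_oscillating.
Qed.
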